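(* Let $N\ge 1$, let $\lambda=\lambda(N)\in\mathbb{GT}_N^+$ be a partition of length $N$, and let $X=(x_1,\dots,x_N)\in\mathbb{C}^N$. Assume that there is $n\in\{1,\dots,N\}$ such that $x_1,\dots,x_n$ are pairwise distinct and $\{x_1,\dots,x_n\}=\{x_1,\dots,x_N\}$. Then $$s_{\lambda}(x_1,\ldots,x_N)=\sum_{\overline{\sigma}\in[\Sigma_N/\Sigma_N^X]^r} \left(\prod_{i=1}^{n}x_i^{|\phi^{(i,\sigma)}(N)|}\right)\left(\prod_{i=1}^{n}s_{\phi^{(i,\sigma)}(N)}(1,\ldots,1)\right)\left(\prod_{i<j,\ x_{\sigma(i)}\neq x_{\sigma(j)}}\frac{1}{x_{\sigma(i)}-x_{\sigma(j)}}\right),$$ where in each summand $\sigma\in\overline{\sigma}$ is an (arbitrary) representative of the coset $\overline{\sigma}$.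
   Context: Notation: $[N]=\{1,\dots,N\}$. $\mathbb{GT}_N^+$ is the set of partitions of length $N$, i.e. integer sequences $\lambda=(\lambda_1\ge\cdots\ge\lambda_N\ge 0)$ (zero parts allowed); $|\lambda|=\sum_i\lambda_i$. For $\lambda\in\mathbb{GT}_N^+$, the Schur polynomial is $s_\lambda(u_1,\dots,u_N)=\det_{i,j\in[N]}(u_i^{\lambda_j+N-j})/\prod_{1\le i<j\le N}(u_i-u_j)$, a symmetric polynomial, evaluated as a polynomial also when some $u_i$ coincide (for $N=1$, $s_\lambda(u_1)=u_1^{\lambda_1}$). $\Sigma_N$ is the permutation group of $[N]$, and $\Sigma_N^X=\{\sigma\in\Sigma_N: x_{\sigma(i)}=x_i \text{ for all } i\in[N]\}$. $[\Sigma_N/\Sigma_N^X]^r$ is the set of right cosets $\Sigma_N^X\sigma=\{\xi\sigma:\xi\in\Sigma_N^X\}$, $\sigma\in\Sigma_N$, where $(\xi\sigma)(k)=\xi(\sigma(k))$. For $\sigma\in\Sigma_N$ and $j\in[N]$ let $\eta_j^{\sigma}(N)=|\{k:k>j,\ x_{\sigma(k)}\neq x_{\sigma(j)}\}|$. For $1\le i\le n$ let $\Phi^{(i,\sigma)}(N)=\{\lambda_j(N)+\eta_j^{\sigma}(N): j\in[N],\ x_{\sigma(j)}=x_i\}$ (a multiset), and let $\phi^{(i,\sigma)}(N)$ be the partition of length $|\{j\in[N]:x_j=x_i\}|$ obtained by arranging the elements of $\Phi^{(i,\sigma)}(N)$ in decreasing order. The number of arguments of $s_{\phi^{(i,\sigma)}(N)}(1,\dots,1)$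 is the length of $\phi^{(i,\sigma)}(N)$. *)

(* Defs.v *)
From mathcomp Require Import all_boot all_order all_fingroup all_algebra.
From mathcomp Require Import mpoly complex reals.

Set Implicit Arguments.
Unset Strict Implicit.
Unset Printing Implicit Defensive.

Import GRing.Theory.
Local Open Scope ring_scope.

(* Indices are 0-based: the exponent lambda_j + N - j, for j in {1, .., N},
   becomes tnth lam j + (N.-1 - j) for j : 'I_N. *)
Definition alternant (K : idomainType) (N : nat) (lam : N.-tuple nat) :
    {mpoly K[N]} :=
  \det (\matrix_(i < N, j < N) 'X_i ^+ (tnth lam j + (N.-1 - j))%N).

Definition vandermonde (K : idomainType) (N : nat) : {mpoly K[N]} :=
  \prod_(i < N) \prod_(j < N | (i < j)%N) ('X_i - 'X_j).

(* Each entry x_i ^+ m is the value at x_i of the remainder of 'X^m modulo the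
   monic polynomial \prod_i ('X - x_i), which has degree N; so the alternant
   matrix is a Vandermonde matrix times a matrix of coefficients. *)
Lemma vandermonde_dvd_det (A : comNzRingType) (N : nat) (x : 'I_N -> A)
    (e : 'I_N -> nat) :
  exists s : A, s * \prod_(i < N) \prod_(j < N | (i < j)%N) (x i - x j) =
                \det (\matrix_(i < N, j < N) x i ^+ e j).
Proof.
pose d : {poly A} := \prod_(i < N) ('X - (x i)%:P).
have d_mon : d \is monic by apply: monic_prod => i _; exact: monicXsubC.
have sd : size d = N.+1.
  by rewrite size_prod_XsubC /index_enum -enumT size_enum_ord.
pose r (j : 'I_N) := Pdiv.Ring.rmodp 'X^(e j) d.
have sr j : (size (r j) <= N)%N.
  by rewrite -ltnS -sd Pdiv.Ring.ltn_rmodpN0 ?monic_neq0.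
have rE i j : (r j).[x i] = x i ^+ e j.
  rewrite -[RHS]hornerXn (Pdiv.RingMonic.rdivp_eq d_mon 'X^_) hornerD hornerM.
  suff -> : d.[x i] = 0 by rewrite mulr0 add0r.
  by rewrite /d horner_prod (bigD1 i) //= hornerXsubC subrr mul0r.
pose a : 'rV[A]_N := \row_i - x i.
pose C : 'M[A]_N := \matrix_(k, j) ((-1) ^+ k * (r j)`_k).
exists (\det C).
have -> : \prod_(i < N) \prod_(j < N | (i < j)%N) (x i - x j) =
          \det (Vandermonde N a)^T.
  rewrite det_tr det_Vandermonde; apply: eq_bigr => i _.
  by apply: eq_bigr => j _; rewrite !mxE opprK addrC.
rewrite mulrC -det_mulmx; congr (\det _); apply/matrixP => i j.
rewrite !mxE -rE (horner_coef_wide _ (sr j)); apply: eq_bigr => k _.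
by rewrite !mxE mulrA -exprMn mulrN1 opprK mulrC.
Qed.

Lemma vandermonde_dvd_alternant (K : idomainType) (N : nat)
    (lam : N.-tuple nat) :
  exists s : {mpoly K[N]}, s * vandermonde K N == alternant K lam.
Proof.
have [s sE] := vandermonde_dvd_det (fun i : 'I_N => 'X_i : {mpoly K[N]})
  (fun j => tnth lam j + (N.-1 - j))%N.
by exists s; apply/eqP.
Qed.

(* The quotient alternant / vandermonde, computed in the polynomial ring; it is
   evaluated at arbitrary points, possibly with repeated coordinates. *)
Definition schur (K : idomainType) (N : nat) (lam : N.-tuple nat) :
    {mpoly K[N]} :=
  xchoose (vandermonde_dvd_alternant K lam).

Lemma schurE (K : idomainType) (N : nat) (lam : N.-tuple nat) :
  schur K lam * vandermonde K N = alternant K lam.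
Proof. exact/eqP/(xchooseP (vandermonde_dvd_alternant K lam)). Qed.

Lemma vandermonde_neq0 (K : idomainType) (N : nat) : vandermonde K N != 0.
Proof.
apply/prodf_neq0 => i _; apply/prodf_neq0 => j lt_ij.
apply/eqP => /(congr1 (mcoeff U_(j))) /eqP; rewrite mcoeffB !mcoeffXU mcoeff0.
by rewrite eqxx (ltn_eqF lt_ij : (i == j) = false) sub0r oppr_eq0 oner_eq0.
Qed.

Lemma schur_unique (K : idomainType) (N : nat) (lam : N.-tuple nat)
    (s : {mpoly K[N]}) :
  s * vandermonde K N = alternant K lam -> s = schur K lam.
Proof. by rewrite -schurE; apply: mulIf; exact: vandermonde_neq0. Qed.

Section Cosets.
Variables (K : idomainType) (N : nat) (x : N.-tuple K).

Definition stab_perm : {set 'S_N} :=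
  [set s : 'S_N | [forall i, tnth x (s i) == tnth x i]].

(* In perm.v, (s * t) k = t (s k), so the composite k |-> xi (sigma k) is
   sigma * xi, and {xi o sigma | xi in stab_perm} is sigma *: stab_perm. *)
Definition perm_cosets : {set {set 'S_N}} :=
  lcosets stab_perm [set: 'S_N].

Definition eta (sigma : 'S_N) (j : 'I_N) : nat :=
  #|[set k : 'I_N | (j < k)%N & tnth x (sigma k) != tnth x (sigma j)]|.

Definition phi (lam : N.-tuple nat) (i : 'I_N) (sigma : 'S_N) : seq nat :=
  sort geq [seq (tnth lam j + eta sigma j)%N | j <- enum 'I_N
             & tnth x (sigma j) == tnth x i].

End Cosets.

(* Main.v *)
Require Import Defs.
From mathcomp Require Import all_boot all_order all_fingroup all_algebra.
From mathcomp Require Import mpoly complex reals.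

Set Implicit Arguments.
Unset Strict Implicit.
Unset Printing Implicit Defensive.

Import GRing.Theory.
Local Open Scope ring_scope.

(** Write y_i for the variables, e_j = lam_j + N - 1 - j for the exponents and
    call two indices a, b equivalent when x_a = x_b.  The alternant is the
    signed sum over all permutations s of the monomials prod_j y_(s j)^(e_j).
    Whenever one class contains several indices the naive termwise
    substitution y := x divides by zero, so the sum is first collected along
    the cosets of the stabiliser of X.

    The coset of s consists of the t with x_(t j) = x_(s j) for all j, and its
    part of the alternant is, up to the sign of s, the determinant of the matrix
    with entries y_(s i)^(e_j) where x_(s i) = x_(s j) and 0 elsewhere
    (sum_perm_coset_det).  This matrix is block diagonal along the classes
    (det_block_diagonal).  Inside the block of the class of x_i the exponent
    e_j is the exponent attached by phi^(i,s) to the rank of j in its class: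
    eta counts the later positions of other classes, and the later positions
    of the same class supply the staircase (phi_exponent).  Hence each block is
    the Schur polynomial of phi^(i,s) times the Vandermonde product of the class
    (det_coset).

    Split the full Vandermonde product, read in the order s, as C_s * I_s where
    C_s (cross) runs over the pairs of inequivalent indices and I_s (inner)
    over the pairs of equivalent ones; C_s * I_s is (-1)^s times the
    Vandermonde product itself.  Each pair of inequivalent indices occurs
    exactly once in C_s, whatever s is, so C_s is C_1 up to a sign and
    C_s^2 = C_1^2 (cross_sqr).  Cancelling the inner factor I_1, which carries
    all the zeros of the Vandermonde product at x, leaves a polynomial identity
    (schur_coset_expansion)

      C_1^2 * s_lam = sum over the cosets of C_s * prod_i s_(phi^(i,s)),

    which may be evaluated at x, where C_1 does not vanish.  There all arguments
    of the i-th Schur polynomial equal x_i, and homogeneity (schur_scale) turns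
    its value into x_i^|phi| s_phi(1, .., 1). *)

(** * Positions satisfying a predicate, in increasing order *)

Section Positions.
Variable N : nat.
Implicit Types (p : pred 'I_N) (i j k : 'I_N).

Definition positions p : seq 'I_N := [seq j <- enum 'I_N | p j].

Lemma positions_sorted p : sorted (fun j k => (j < k)%N) (positions p).
Proof.
apply: sorted_filter => [j i k|]; first exact: ltn_trans.
by rewrite -[sorted _ _](sorted_map (f := val) (e' := ltn))
  val_enum_ord iota_ltn_sorted.
Qed.

Lemma positions_uniq p : uniq (positions p).
Proof. exact/filter_uniq/enum_uniq. Qed.

Lemma mem_positions p j : (j \in positions p) = p j.
Proof. by rewrite mem_filter mem_enum andbT. Qed.

Lemma ltn_nth_positions p j0 (a b : nat) :
  (a < size (positions p))%N -> (b < size (positions p))%N ->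
  (nth j0 (positions p) a < nth j0 (positions p) b)%N = (a < b)%N.
Proof.
move=> ltan ltbn.
have tr : transitive (fun j k : 'I_N => (j < k)%N).
  by move=> j i k; exact: ltn_trans.
have nthS := sorted_ltn_nth tr j0 (positions_sorted p).
have [ltab|ltba|->] := ltngtP a b; last by rewrite ltnn.
  exact: nthS.
by apply/negbTE; rewrite -leqNgt ltnW //; apply: nthS.
Qed.

Lemma card_positions_gt p j0 (a : nat) : (a < size (positions p))%N ->
  #|[set k : 'I_N | (nth j0 (positions p) a < k)%N & p k]| =
  (size (positions p) - a.+1)%N.
Proof.
move=> ltan; rewrite cardsE cardE -size_drop.
apply/perm_size/uniq_perm => [||k]; first exact: enum_uniq.
  exact/drop_uniq/positions_uniq.
rewrite mem_enum; apply/andP/idP => [[ltk pk]|].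
  have kP : k \in positions p by rewrite mem_positions.
  move: ltk; rewrite -{1}(nth_index j0 kP) ltn_nth_positions ?index_mem //.
  move=> lt.
  rewrite -(nth_index j0 kP) -(subnKC lt) -nth_drop mem_nth //.
  by rewrite size_drop ltn_sub2r ?index_mem // (leq_ltn_trans lt) ?index_mem.
case/(nthP j0) => b; rewrite size_drop ltn_subRL => ltb <-; rewrite nth_drop.
split; last by rewrite -mem_positions mem_nth.
by rewrite ltn_nth_positions // leq_addr.
Qed.

End Positions.

Lemma card_ord_gt (n : nat) (i : 'I_n) :
  #|[set k : 'I_n | (i < k)%N]| = (n.-1 - i)%N.
Proof.
have eP : positions (@predT 'I_n) = enum 'I_n by exact: filter_predT.
have := @card_positions_gt n predT i i; rewrite eP size_enum_ord nth_ord_enum.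
rewrite subnS -subn1 subnAC subn1 => <- //.
by apply: eq_card => k; rewrite !inE andbT.
Qed.

(** * Determinants of matrices that are block diagonal up to reordering *)

Section BlockDeterminant.
Variable A : comNzRingType.

(** The two sizes are only propositionally equal because the lemma serves for
    reindexing by a concatenation of two lists, whose length is a sum. *)
Lemma det_mxsub_inj (m n : nat) (emn : m = n) (f : 'I_m -> 'I_n) (M : 'M[A]_n) :
  injective f -> \det (mxsub f f M) = \det M.
Proof.
case: n / emn f M => f M finj.
have -> : mxsub f f M = row_perm (perm finj) (col_perm (perm finj) M).
  by apply/matrixP => i j; rewrite !mxE !permE.
rewrite row_permE col_permE !det_mulmx !det_perm mulrCA odd_permV.
by rewrite -signr_addb addbb mulr1.
Qed.

(** Listing the positions in p before the others makes M block lower triangular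
    with an identity block at the bottom right.  The size m is a parameter so
    that the right-hand side can be a matrix indexed by the length of a
    partition. *)
Lemma det_id_outside (n m : nat) (p : pred 'I_n) (j0 : 'I_n) (M : 'M[A]_n) :
  (forall i j, p i -> ~~ p j -> M i j = 0) ->
  (forall i j, ~~ p i -> M i j = (i == j)%:R) ->
  m = size (positions p) ->
  \det M = \det (\matrix_(a < m, b < m)
    M (nth j0 (positions p) a) (nth j0 (positions p) b)).
Proof.
move=> M0 M1 ->; set J := positions p; pose J' := positions (predC p).
have eJ : (size J + size J')%N = n.
  by rewrite !size_filter count_predC size_enum_ord.
have uJ : uniq (J ++ J').
  rewrite cat_uniq; apply/and3P; split; rewrite ?positions_uniq //.
  by apply/hasPn => j; rewrite !mem_positions.
pose f (a : 'I_(size J + size J')) := nth j0 (J ++ J') a.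
have finj : injective f.
  by move=> a b /eqP; rewrite /f nth_uniq ?size_cat // => /eqP/val_inj.
rewrite -(det_mxsub_inj eJ M finj) -[mxsub f f M]submxK.
have fl a : f (lshift _ a) = nth j0 J a by rewrite /f nth_cat /= ltn_ord.
have fr a : f (rshift _ a) = nth j0 J' a.
  by rewrite /f nth_cat /= ltnNge leq_addr addKn.
have pl (a : 'I_(size J)) : p (nth j0 J a) by rewrite -mem_positions mem_nth.
have pr (a : 'I_(size J')) : ~~ p (nth j0 J' a).
  by rewrite -[~~ _](mem_positions (predC p)) mem_nth.
have -> : ursubmx (mxsub f f M) = 0.
  by apply/matrixP => a b; rewrite !mxE fl fr M0.
have -> : drsubmx (mxsub f f M) = 1%:M.
  apply/matrixP => a b; rewrite !mxE !fr M1 //.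
  by rewrite nth_uniq ?positions_uniq.
rewrite det_lblock det1 mulr1; congr (\det _).
by apply/matrixP => a b; rewrite !mxE !fl.
Qed.

(** M is the product, over the classes v, of the matrices that agree with M on
    the rows of v and with the identity on the other rows; each factor is
    covered by det_id_outside. *)
Lemma det_block_diagonal (I : finType) (P : pred I) (n : nat) (c : 'I_n -> I)
    (m : I -> nat) (j0 : 'I_n) (M : 'M[A]_n) :
  (forall j, P (c j)) ->
  (forall i j, c i != c j -> M i j = 0) ->
  (forall v, P v -> m v = size (positions (fun j => c j == v))) ->
  \det M = \prod_(v | P v) \det (\matrix_(a < m v, b < m v)
     M (nth j0 (positions (fun j => c j == v)) a)
       (nth j0 (positions (fun j => c j == v)) b)).
Proof.
move=> Pc M0 mE.
(* L s keeps the rows of M whose class lies in s; the product of the L [:: v]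
   is built one class at a time. *)
pose L (s : seq I) : 'M[A]_n :=
  \matrix_(i, j) if c i \in s then M i j else (i == j)%:R.
have L_cons v s : v \notin s -> L (v :: s) = L [:: v] *m L s.
  move=> vs; apply/matrixP => i j; rewrite !mxE inE.
  have [civ|civ] /= := eqVneq (c i) v.
    rewrite (bigD1 j) //= !mxE inE civ eqxx /=.
    have [cj|cj] := eqVneq (c j) v.
      rewrite cj (negPf vs) eqxx mulr1 big1 ?addr0 // => k kj.
      rewrite !mxE inE civ eqxx; have [ck|ck] := eqVneq (c k) v.
        by rewrite ck (negPf vs) (negPf kj) mulr0.
      by rewrite M0 ?mul0r // civ eq_sym.
    rewrite M0 ?mul0r ?add0r ?big1 // => [k kj|]; last by rewrite civ eq_sym.
    rewrite !mxE inE civ eqxx; have [ck|ck] := eqVneq (c k) v.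
      by rewrite ck (negPf vs) (negPf kj) mulr0.
    by rewrite M0 ?mul0r // civ eq_sym.
  rewrite (bigD1 i) //= !mxE inE (negPf civ) eqxx mul1r big1 ?addr0 // => k ki.
  by rewrite !mxE inE (negPf civ) eq_sym (negPf ki) mul0r.
have detL s : uniq s -> \det (L s) = \prod_(v <- s) \det (L [:: v]).
  elim: s => [_|v s IH /andP[vs us]].
    rewrite big_nil -(det1 A n); congr (\det _).
    by apply/matrixP => i j; rewrite !mxE.
  by rewrite big_cons L_cons // det_mulmx IH.
have -> : M = L (enum P).
  by apply/matrixP => i j; rewrite !mxE mem_enum [_ \in P]Pc.
rewrite detL ?enum_uniq // big_enum; apply: eq_bigr => v Pv.
rewrite (@det_id_outside _ (m v) (fun j => c j == v) j0); last 1 first.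
- by rewrite mE.
- congr (\det _); apply/matrixP => a b; rewrite !mxE inE.
  have lt d : (d < m v)%N -> c (nth j0 (positions (fun j => c j == v)) d) = v.
    move=> ltd; apply/eqP.
    by rewrite -(mem_positions (fun j => c j == v)) mem_nth -?mE.
  by rewrite mem_enum [_ \in P]Pc lt // eqxx.
- by move=> i j /eqP ci cj; rewrite !mxE inE ci eqxx M0 // ci eq_sym.
- by move=> i j ci; rewrite !mxE inE (negPf ci).
Qed.

End BlockDeterminant.

(** * Products over increasing pairs *)

Section PairProducts.
Variable A : comNzRingType.

(** A symmetric function of two indices is a function of the unordered pair, and
    s permutes the unordered pairs: a pair keeps its orientation under s, or
    is reversed, which does not change h. *)
Lemma prod_lt_perm_sym (n : nat) (s : 'S_n) (h : 'I_n -> 'I_n -> A) :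
  (forall i j, h i j = h j i) ->
  \prod_(i < n) \prod_(j < n | (i < j)%N) h (s i) (s j) =
  \prod_(i < n) \prod_(j < n | (i < j)%N) h i j.
Proof.
move=> hC; rewrite !pair_big_dep /=.
pose t (p : 'I_n * 'I_n) := ((s^-1)%g p.1, (s^-1)%g p.2).
have t_inj : injective t.
  by move=> [i j] [k l] [/perm_inj -> /perm_inj ->].
pose P (p : 'I_n * 'I_n) := (p.1 < p.2)%N.
rewrite (reindex_inj t_inj) /=.
under eq_bigr do rewrite !permKV.
(* The pairs with both orders agreeing are common to the two sides; the
   remaining ones are exchanged by swapping the components. *)
rewrite (bigID P) [RHS](bigID (fun p => P (t p))) /=; congr (_ * _).
  by apply: eq_bigl => p; rewrite andbC.
have sw_inj : injective (fun p : 'I_n * 'I_n => (p.2, p.1)).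
  by move=> [i j] [k l] [-> ->].
rewrite (reindex_inj sw_inj) /=; apply: eq_big => [[i j]|[i j] _] //=.
rewrite /P /= -!leqNgt ltn_neqAle [(i < j)%N]ltn_neqAle -!andbA.
rewrite [(i <= j)%N && _]andbC; congr (_ && _).
by rewrite !(inj_eq val_inj) (inj_eq perm_inj) eq_sym.
Qed.

Lemma prod_lt_perm_sub (n : nat) (s : 'S_n) (x : 'I_n -> A) :
  \prod_(i < n) \prod_(j < n | (i < j)%N) (x (s i) - x (s j)) =
  (-1) ^+ s * \prod_(i < n) \prod_(j < n | (i < j)%N) (x i - x j).
Proof.
have vdmE (y : 'I_n -> A) :
    \prod_(i < n) \prod_(j < n | (i < j)%N) (y i - y j) =
    \det (Vandermonde n (\row_i - y i)).
  rewrite det_Vandermonde; apply: eq_bigr => i _.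
  by apply: eq_bigr => j _; rewrite !mxE opprK addrC.
rewrite !vdmE -det_perm -[X in X * _]det_tr tr_perm_mx mulrC -det_mulmx.
rewrite -col_permE; congr (\det _).
by apply/matrixP => i j; rewrite !mxE.
Qed.

Lemma prod_lt_classes (I : finType) (P : pred I) (n : nat) (c : 'I_n -> I)
    (m : I -> nat) (j0 : 'I_n) (g : 'I_n -> 'I_n -> A) :
  (forall j, P (c j)) ->
  (forall v, P v -> m v = size (positions (fun j => c j == v))) ->
  \prod_(j < n) \prod_(k < n | (j < k)%N && (c j == c k)) g j k =
  \prod_(v | P v) \prod_(a < m v) \prod_(b < m v | (a < b)%N)
    g (nth j0 (positions (fun j => c j == v)) a)
      (nth j0 (positions (fun j => c j == v)) b).
Proof.
move=> Pc mE; rewrite (partition_big c P) //=; apply: eq_bigr => v Pv.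
rewrite mE //; set J := positions _.
transitivity (\prod_(j <- J) \prod_(k <- J | (j < k)%N) g j k).
  rewrite big_filter big_enum_cond; apply: eq_bigr => j /eqP cj.
  rewrite big_filter_cond big_enum_cond; apply: eq_bigl => k.
  by rewrite cj andbC [v == _]eq_sym.
rewrite (big_nth j0) big_mkord; apply: eq_bigr => a _.
rewrite (big_nth j0) big_mkord; apply: eq_bigl => b.
exact: ltn_nth_positions.
Qed.

End PairProducts.

(** * Schur polynomials under ring morphisms, and their homogeneity *)

Lemma rmorph_mmap (n : nat) (K A B : comNzRingType) (f : K -> A)
    (f' : K -> B) (h : 'I_n -> A) (h' : 'I_n -> B) (g : {rmorphism A -> B})
    (p : {mpoly K[n]}) :
  (forall c, g (f c) = f' c) -> (forall i, g (h i) = h' i) ->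
  g (mmap f h p) = mmap f' h' p.
Proof.
move=> gf gh; rewrite /mmap rmorph_sum; apply: eq_bigr => m _.
rewrite rmorphM gf rmorph_prod; congr (_ * _); apply: eq_bigr => i _.
by rewrite rmorphXn gh.
Qed.

Section SchurMorphism.
Variables (K : idomainType) (n : nat) (lam : n.-tuple nat).

(** The defining equation of the Schur polynomial, pushed to any commutative
    ring: it is used with polynomials as arguments, before any specialisation
    can make the Vandermonde product vanish. *)
Lemma mmap_schurE (A : comNzRingType) (f : {rmorphism K -> A})
    (h : 'I_n -> A) :
  mmap f h (schur K lam) * \prod_(i < n) \prod_(j < n | (i < j)%N) (h i - h j) =
  \det (\matrix_(i < n, j < n) h i ^+ (tnth lam j + (n.-1 - j))).
Proof.
have hX i : mmap f h 'X_i = h i by rewrite mmapX mmap1U.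
have -> : \prod_(i < n) \prod_(j < n | (i < j)%N) (h i - h j) =
          mmap f h (vandermonde K n).
  rewrite rmorph_prod; apply: eq_bigr => i _.
  by rewrite rmorph_prod; apply: eq_bigr => j _; rewrite rmorphB /= !hX.
rewrite -rmorphM schurE -det_map_mx; congr (\det _).
by apply/matrixP => i j; rewrite !mxE rmorphXn /= hX.
Qed.

(** Homogeneity of degree |lam| on the diagonal.  Scaling the variables by an
    indeterminate T multiplies the j-th column of the alternant by T^(e_j) and
    the Vandermonde product by T^(0 + 1 + .. + (n - 1)), and over polynomials
    both T and the Vandermonde product can be cancelled; then T is set to c and
    all variables to 1.  An indeterminate is used instead of c because c may
    be 0. *)
Lemma schur_scale (c : K) :
  (schur K lam).@[fun=> c] = c ^+ sumn lam * (schur K lam).@[fun=> 1].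
Proof.
pose f : {rmorphism K -> {poly {mpoly K[n]}}} := polyC \o @mpolyC n K.
pose h (i : 'I_n) : {poly {mpoly K[n]}} := ('X_i)%:P.
have scaled : mmap f (fun i => 'X * h i) (schur K lam) =
              'X ^+ sumn lam * mmap f h (schur K lam).
  have V0 : \prod_(i < n) \prod_(j < n | (i < j)%N) ('X * h i - 'X * h j) != 0.
    apply/prodf_neq0 => i _; apply/prodf_neq0 => j ltij.
    rewrite -mulrBr mulf_neq0 ?polyX_eq0 // -polyCB polyC_eq0.
    have /prodf_neq0/(_ i isT)/prodf_neq0/(_ j ltij) := vandermonde_neq0 K n.
    by [].
  apply: (mulIf V0); rewrite mmap_schurE.
  have -> : \prod_(i < n) \prod_(j < n | (i < j)%N) ('X * h i - 'X * h j) =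
      \prod_(i < n) 'X ^+ (n.-1 - i) *
      \prod_(i < n) \prod_(j < n | (i < j)%N) (h i - h j).
    rewrite -big_split; apply: eq_bigr => i _ /=.
    under eq_bigr do rewrite -mulrBr.
    rewrite big_split /= prodr_const; congr (_ ^+ _ * _).
    by rewrite -card_ord_gt cardsE.
  rewrite [RHS]mulrACA mmap_schurE.
  have -> : 'X ^+ sumn lam =
            \prod_(j < n) 'X ^+ tnth lam j :> {poly {mpoly K[n]}}.
    by rewrite sumnE big_tuple expr_sum.
  pose d : 'rV[{poly {mpoly K[n]}}]_n := \row_j 'X ^+ (tnth lam j + (n.-1 - j)).
  have -> : \prod_(j < n) 'X ^+ tnth lam j * \prod_(j < n) 'X ^+ (n.-1 - j) =
            \det (diag_mx d).
    by rewrite det_diag -big_split; apply: eq_bigr => j _; rewrite !mxE exprD.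
  rewrite mulrC -det_mulmx mul_mx_diag; congr (\det _).
  by apply/matrixP => i j; rewrite !mxE exprMn mulrC.
pose g : {rmorphism {poly {mpoly K[n]}} -> K} :=
  meval (fun=> 1) \o horner_eval c%:MP.
have gC a : g (f a) = a by rewrite /= /horner_eval hornerC mevalC.
have gX : g 'X = c by rewrite /= /horner_eval hornerX mevalC.
have gh i : g (h i) = 1 by rewrite /= /horner_eval hornerC mevalXU.
have := congr1 g scaled; rewrite rmorphM rmorphXn gX.
rewrite (rmorph_mmap (f' := idfun) (h' := fun=> 1) _ gC gh).
rewrite (rmorph_mmap (f' := idfun) (h' := fun=> c) _ gC) // => i.
by rewrite rmorphM gX gh mulr1.
Qed.

End SchurMorphism.

(** * The partitions phi and the staircase of each class *)

Section SortedParts.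
Variables (K : idomainType) (N : nat) (lam : N.-tuple nat) (x : N.-tuple K).
Hypothesis lam_sorted : sorted geq lam.
Variables (i : 'I_N) (s : 'S_N).

Let J := positions (fun j => tnth x (s j) == tnth x i).

Lemma eta_add_same (j : 'I_N) :
  (eta x s j +
   #|[set k : 'I_N | (j < k)%N & tnth x (s k) == tnth x (s j)]|)%N =
  (N.-1 - j)%N.
Proof.
rewrite -card_ord_gt addnC.
rewrite -(cardsID [set k | tnth x (s k) == tnth x (s j)]
                 [set k : 'I_N | (j < k)%N]).
by congr (_ + _)%N; apply: eq_card => k; rewrite !inE // andbC.
Qed.

(** Both lam_j and, within a class, eta_j are nonincreasing in j, so sorting
    does nothing and the parts of phi are attached to positions. *)
Lemma phiE : phi x lam i s = [seq (tnth lam j + eta x s j)%N | j <- J].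
Proof.
apply: sorted_sort; first by move=> a b c ab bc; exact: leq_trans bc ab.
rewrite sorted_map.
apply: (sub_in_sorted (P := fun j => tnth x (s j) == tnth x i)
                      (e := fun j k : 'I_N => (j < k)%N)).
- move=> j k /eqP xj /eqP xk ltjk; rewrite /relpre /= leq_add //.
    rewrite !(tnth_nth 0%N).
    apply: (sorted_ltn_nth (leT := geq)) => //; rewrite ?inE ?size_tuple //.
    by move=> a b c ab bc; exact: leq_trans bc ab.
  apply/subset_leq_card/subsetP => l; rewrite !inE xj xk => /andP[ltkl ->].
  by rewrite (ltn_trans ltjk).
- exact: filter_all.
- exact: positions_sorted.
Qed.

Lemma size_phi : size (phi x lam i s) = size J.
Proof. by rewrite phiE size_map. Qed.

(** The heart of the combinatorics: of the N - 1 - j positions after j,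
    eta_j lie in other classes and the others are exactly those which follow j
    in the list of its class, so the exponents of the alternant of lam
    restricted to a class are those of the alternant of phi. *)
Lemma phi_exponent (j0 : 'I_N) (a : 'I_(size (phi x lam i s))) :
  (tnth (in_tuple (phi x lam i s)) a + ((size (phi x lam i s)).-1 - a))%N =
  (tnth lam (nth j0 J a) + (N.-1 - nth j0 J a))%N.
Proof.
rewrite (tnth_nth 0%N); case: a => a /=; rewrite size_phi => ltaJ.
rewrite phiE (nth_map j0) // -addnA -eta_add_same -subn1 -subnDA.
congr (_ + (_ + _))%N; rewrite add1n.
have xa : tnth x (s (nth j0 J a)) = tnth x i.
  apply/eqP.
  rewrite -[_ == _](mem_positions (fun j => tnth x (s j) == tnth x i)).
  exact: mem_nth.
rewrite -(card_positions_gt j0 ltaJ).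
by apply: eq_card => k; rewrite !inE xa.
Qed.

End SortedParts.

(** * The alternant along a coset of the stabiliser *)

Section Cosets.
Variables (K : idomainType) (N : nat) (x : N.-tuple K).

Lemma stab_perm_group_set : group_set (stab_perm x).
Proof.
apply/group_setP; split=> [|s t].
  by rewrite inE; apply/forallP => i; rewrite perm1.
rewrite !inE => /forallP xs /forallP xt; apply/forallP => i.
by rewrite permM (eqP (xt _)) (eqP (xs _)).
Qed.

Canonical stab_perm_group := Group stab_perm_group_set.

Lemma mem_perm_coset (B : {set 'S_N}) (s t : 'S_N) :
  B \in perm_cosets x -> s \in B ->
  (t \in B) = [forall j, tnth x (t j) == tnth x (s j)].
Proof.
case/lcosetsP => u _ -> /lcoset_eqP <-; rewrite mem_lcoset inE.
apply/forallP/forallP => xst j; last by rewrite permM (eqP (xst _)) permKV.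
by have := xst (s j); rewrite permM permK.
Qed.

Lemma sum_perm_cosets (A : nmodType) (F : 'S_N -> A) :
  \sum_s F s = \sum_(B in perm_cosets x) \sum_(s in B) F s.
Proof.
rewrite (partition_big (fun s => s *: stab_perm x)%g (mem (perm_cosets x))).
  apply: eq_bigr => B /lcosetsP[u _ ->]; apply: eq_bigl => s.
  by apply/eqP/lcoset_eqP.
by move=> s _; apply/lcosetsP; exists s.
Qed.

(** In the Leibniz formula for the right-hand side the zero entries kill
    exactly the permutations outside the coset. *)
Lemma sum_perm_coset_det (A : comNzRingType) (y : 'I_N -> A) (e : 'I_N -> nat)
    (B : {set 'S_N}) (s : 'S_N) :
  B \in perm_cosets x -> s \in B ->
  \sum_(t in B) (-1) ^+ t * \prod_j y (t j) ^+ e j =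
  (-1) ^+ s * \det (\matrix_(i, j)
    if tnth x (s i) == tnth x (s j) then y (s i) ^+ e j else 0).
Proof.
move=> BX sB; rewrite -det_tr big_distrr /=.
rewrite (reindex_inj (mulIg s)) [LHS]big_mkcond; apply: eq_bigr => t _ /=.
rewrite (mem_perm_coset _ BX sB).
under [in RHS]eq_bigr do rewrite !mxE.
case: ifPn => [/forallP xts|/forallPn[j xts]].
  rewrite odd_permM signr_addb mulrCA mulrA; congr (_ * _).
  by apply: eq_bigr => j _; have := xts j; rewrite permM => ->.
rewrite [\prod_i _](bigD1 j) //=; move: xts; rewrite permM => /negPf ->.
by rewrite mul0r !mulr0.
Qed.

End Cosets.

(** Classes of equal coordinates are indexed by the first n indices: c j is
    the first index with the value x_j. *)
Lemma exists_class_index (K : eqType) (N n : nat) (X : N.-tuple K) :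
  uniq (take n X) -> take n X =i X ->
  exists c : 'I_N -> 'I_N, (forall j, c j < n)%N /\
    forall (j i : 'I_N), (i < n)%N -> (c j == i) = (tnth X j == tnth X i).
Proof.
move=> uX XE.
have ltc j : (index (tnth X j) X < N)%N.
  by rewrite -[ltnRHS](size_tuple X) index_mem mem_tnth.
exists (fun j => Ordinal (ltc j)); split=> [j|j i ltin] /=.
  by rewrite -in_take ?mem_tnth // XE mem_tnth.
have iE : index (tnth X i) X = i.
  have ti : tnth X i = nth (tnth X i) (take n X) i.
    by rewrite nth_take // -tnth_nth.
  rewrite -[in index _ _](cat_take_drop n X) index_cat XE mem_tnth {1}ti.
  rewrite index_uniq //.
  by rewrite size_take size_tuple; case: ifP.
apply/eqP/eqP => [<-|xji]; last by apply: val_inj; rewrite /= xji iE.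
by rewrite (tnth_nth (tnth X j) X (Ordinal _)) nth_index ?mem_tnth.
Qed.

(** * Cancelling the singular factor *)

Section Expansion.
Variables (K : fieldType) (N n : nat) (lam : N.-tuple nat) (X : N.-tuple K).
(* j0 is only a default value for nth. *)
Variable j0 : 'I_N.
Hypothesis lam_sorted : sorted geq lam.
Hypothesis X_distinct : uniq (take n X).
Hypothesis X_values : take n X =i X.

Local Notation class_pos s i := (positions (fun j => tnth X (s j) == tnth X i)).

(** The part of the Vandermonde product, in the order s, that survives at
    y = x; the values X decide which pairs belong to it, whatever the
    ring containing y. *)
Definition cross (A : comNzRingType) (y : 'I_N -> A) (s : 'S_N) : A :=
  \prod_(i < N) \prod_(j < N | (i < j)%N && (tnth X (s i) != tnth X (s j)))
    (y (s i) - y (s j)).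

(** The part of the Vandermonde product that vanishes at y = x as soon as two
    coordinates coincide. *)
Definition inner (A : comNzRingType) (y : 'I_N -> A) (s : 'S_N) : A :=
  \prod_(i < N) \prod_(j < N | (i < j)%N && (tnth X (s i) == tnth X (s j)))
    (y (s i) - y (s j)).

Lemma cross_mul_inner (A : comNzRingType) (y : 'I_N -> A) (s : 'S_N) :
  cross y s * inner y s =
  (-1) ^+ s * \prod_(i < N) \prod_(j < N | (i < j)%N) (y i - y j).
Proof.
rewrite -prod_lt_perm_sub -big_split; apply: eq_bigr => i _ /=.
by rewrite [RHS](bigID (fun j => tnth X (s i) == tnth X (s j))) /= mulrC.
Qed.

(** Reordering the indices only changes the sign of each factor, and a square
    forgets signs: this replaces any computation of the sign of the ratio of
    two cross factors. *)
Lemma cross_sqr (A : comNzRingType) (y : 'I_N -> A) (s : 'S_N) :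
  cross y s ^+ 2 = cross y 1%g ^+ 2.
Proof.
pose h i j := if tnth X i != tnth X j then (y i - y j) ^+ 2 else 1.
have crossE t : cross y t ^+ 2 =
    \prod_(i < N) \prod_(j < N | (i < j)%N) h (t i) (t j).
  rewrite -prodrXl; apply: eq_bigr => i _.
  by rewrite -prodrXl big_mkcondr.
rewrite !crossE.
under [RHS]eq_bigr do under eq_bigr do rewrite !perm1.
apply: prod_lt_perm_sym => i j; rewrite /h eq_sym.
by case: ifP => // _; rewrite -sqrrN opprB.
Qed.

(** The arguments of the i-th Schur polynomial are the y_a with x_a = x_i,
    listed in the order in which s reaches them; this order makes the
    Vandermonde products of the blocks multiply to inner y s with no sign. *)
Definition class_schur (A : comNzRingType) (f : K -> A) (y : 'I_N -> A)
    (s : 'S_N) : A :=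
  \prod_(i < N | (i < n)%N)
    mmap f (fun a => y (s (nth j0 (class_pos s i) a)))
      (schur K (in_tuple (phi X lam i s))).

(** Class by class: each diagonal block is the alternant of phi^(i,s) in the
    variables of the class, hence a Schur polynomial times a Vandermonde
    product, and the latter are exactly the pairs collected in inner. *)
Lemma det_coset (A : comNzRingType) (f : {rmorphism K -> A}) (y : 'I_N -> A)
    (s : 'S_N) :
  \det (\matrix_(i < N, j < N) if tnth X (s i) == tnth X (s j)
          then y (s i) ^+ (tnth lam j + (N.-1 - j)) else 0) =
  class_schur f y s * inner y s.
Proof.
have [c [cn cE]] := exists_class_index X_distinct X_values.
have posE (i : 'I_N) : (i < n)%N ->
    positions (fun j => c (s j) == i) = class_pos s i.
  by move=> ltin; apply: eq_filter => j; rewrite cE.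
have cc i j : (c (s i) == c (s j)) = (tnth X (s i) == tnth X (s j)).
  rewrite cE //; have := cE (s j) (c (s j)) (cn _); rewrite eqxx.
  by move/esym/eqP => ->.
have sizeE (v : 'I_N) : (v < n)%N ->
    size (phi X lam v s) = size (positions (fun j => c (s j) == v)).
  by move=> ltvn; rewrite size_phi // posE.
rewrite (det_block_diagonal (P := fun v : 'I_N => (v < n)%N)
  (c := fun j => c (s j)) j0 _ _ sizeE) => [|j|i j]; last 2 first.
- exact: cn.
- by rewrite cc mxE => /negPf ->.
rewrite /inner.
under [X in _ * X]eq_bigr do under eq_bigl do rewrite -cc.
rewrite (prod_lt_classes j0 (P := fun v : 'I_N => (v < n)%N)
  (c := fun j => c (s j)) _ _ sizeE) => [|j]; last exact: cn.
rewrite -big_split; apply: eq_bigr => v ltvn /=.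
rewrite posE // mmap_schurE; congr (\det _); apply/matrixP => a b.
rewrite !mxE (phi_exponent lam_sorted j0).
have xJ (d : 'I_(size (phi X lam v s))) :
    tnth X (s (nth j0 (class_pos s v) d)) = tnth X v.
  apply/eqP.
  rewrite -[_ == _](mem_positions (fun j => tnth X (s j) == tnth X v)).
  by rewrite mem_nth // -(size_phi X lam_sorted).
by rewrite !xJ eqxx.
Qed.

(** The square on the left is the price of cross_sqr: the coset of s first
    contributes (-1)^s * inner y s, and multiplying by cross y 1 makes it
    cross y s * inner y 1, whose second factor is common to all cosets. *)
Lemma schur_coset_expansion (rep : {set 'S_N} -> 'S_N) :
  (forall B, B \in perm_cosets X -> rep B \in B) ->
  cross (fun i => 'X_i) 1%g ^+ 2 * schur K lam =
  \sum_(B in perm_cosets X)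
    cross (fun i => 'X_i) (rep B) *
    class_schur (@mpolyC N K) (fun i => 'X_i) (rep B).
Proof.
move=> repP; set y : 'I_N -> {mpoly K[N]} := fun i => 'X_i.
have VE : cross y 1%g * inner y 1%g = vandermonde K N.
  by rewrite cross_mul_inner odd_perm1 mul1r.
have inner0 : inner y 1%g != 0.
  by apply: contraNneq (vandermonde_neq0 K N) => i0; rewrite -VE i0 mulr0.
apply: (mulIf inner0).
have -> : cross y 1%g ^+ 2 * schur K lam * inner y 1%g =
          cross y 1%g * alternant K lam.
  by rewrite -schurE -VE expr2 -!mulrA (mulrCA (schur K lam)).
have -> : alternant K lam = \sum_(s : 'S_N)
    (-1) ^+ s * \prod_j y (s j) ^+ (tnth lam j + (N.-1 - j)).
  rewrite /alternant -det_tr; apply: eq_bigr => s _; congr (_ * _).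
  by apply: eq_bigr => j _; rewrite !mxE.
rewrite (sum_perm_cosets X) mulr_sumr mulr_suml; apply: eq_bigr => B BX.
have sB := repP B BX; set s := rep B in sB *.
rewrite (sum_perm_coset_det _ _ BX sB) (det_coset (@mpolyC N K)).
have cross0 : cross y 1%g != 0.
  by apply: contraNneq (vandermonde_neq0 K N) => i0; rewrite -VE i0 mul0r.
suff swap : cross y 1%g * ((-1) ^+ s * inner y s) = cross y s * inner y 1%g.
  by rewrite [RHS]mulrAC -swap -!mulrA [inner _ _ * _]mulrC.
apply: (mulfI cross0); rewrite mulrA -expr2 -(cross_sqr y s).
rewrite expr2 -mulrA [X in _ * X = _]mulrCA cross_mul_inner signrMK.
by rewrite [RHS]mulrCA VE.
Qed.

End Expansion.

(** * Evaluation at X *)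

Lemma schur_eval_coset_sum (K : fieldType) (N n : nat) (lam : N.-tuple nat)
    (X : N.-tuple K) (rep : {set 'S_N} -> 'S_N) :
  (0 < N)%N -> sorted geq lam -> uniq (take n X) -> take n X =i X ->
  (forall B, B \in perm_cosets X -> rep B \in B) ->
  (schur K lam).@[tnth X] =
  \sum_(B in perm_cosets X)
    (\prod_(i < N | (i < n)%N) tnth X i ^+ sumn (phi X lam i (rep B))) *
    (\prod_(i < N | (i < n)%N)
       (schur K (in_tuple (phi X lam i (rep B)))).@[fun=> 1]) *
    (\prod_(i < N)
       \prod_(j < N | (i < j)%N && (tnth X (rep B i) != tnth X (rep B j)))
         (1 / (tnth X (rep B i) - tnth X (rep B j)))).
Proof.
move=> N0 lamS uX XE repP; pose j0 := Ordinal N0.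
have crossE s : (cross X (fun i => 'X_i : {mpoly K[N]}) s).@[tnth X] =
                cross X (tnth X) s.
  rewrite rmorph_prod; apply: eq_bigr => i _; rewrite rmorph_prod.
  by apply: eq_bigr => j _; rewrite rmorphB /= !mevalXU.
have cross0 s : cross X (tnth X) s != 0.
  apply/prodf_neq0 => i _; apply/prodf_neq0 => j /andP[_].
  by rewrite subr_eq0.
have schurC s :
    (class_schur n lam X j0 (@mpolyC N K) (fun i => 'X_i) s).@[tnth X] =
    (\prod_(i < N | (i < n)%N) tnth X i ^+ sumn (phi X lam i s)) *
    (\prod_(i < N | (i < n)%N) (schur K (in_tuple (phi X lam i s))).@[fun=> 1]).
  rewrite rmorph_prod -big_split; apply: eq_bigr => i ltin.
  rewrite /= -(schur_scale (in_tuple (phi X lam i s))).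
  apply: rmorph_mmap => [c|a]; first exact: mevalC.
  rewrite /= mevalXU; apply/eqP.
  rewrite -[_ == _](mem_positions (fun j => tnth X (s j) == tnth X i)).
  by rewrite mem_nth // -(size_phi X lamS).
have := congr1 (meval (tnth X)) (schur_coset_expansion j0 lamS uX XE repP).
rewrite rmorphM rmorphXn /= crossE => E.
have C0 : cross X (tnth X) 1%g ^+ 2 != 0 by rewrite expf_neq0.
apply: (mulfI C0); rewrite E rmorph_sum mulr_sumr; apply: eq_bigr => B _.
rewrite rmorphM /= crossE schurC [RHS]mulrCA [LHS]mulrC; congr (_ * _).
have -> : \prod_(i < N)
    \prod_(j < N | (i < j)%N && (tnth X (rep B i) != tnth X (rep B j)))
      (1 / (tnth X (rep B i) - tnth X (rep B j))) =
  (cross X (tnth X) (rep B))^-1.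
  rewrite -prodfV; apply: eq_bigr => i _; rewrite -prodfV.
  by apply: eq_bigr => j _; rewrite div1r.
(* C_s / C_1 ^ 2 = C_s / C_s ^ 2 = 1 / C_s. *)
by rewrite -(cross_sqr X _ (rep B)) expr2 mulfK.
Qed.

Theorem theorem2p4 (R : realType) (N : nat) (lam : N.-tuple nat)
    (X : N.-tuple R[i]) (n : nat)
    (N_ge1 : (1 <= N)%N)
    (lam_partition : sorted geq lam)
    (n_range : (1 <= n <= N)%N)
    (X_distinct : uniq (take n X))
    (X_values : take n X =i X)
    (rep : {set 'S_N} -> 'S_N)
    (rep_in : forall B : {set 'S_N}, B \in perm_cosets X -> rep B \in B) :
  (schur R[i] lam).@[tnth X] =
  \sum_(B in perm_cosets X)
    (\prod_(i < N | (i < n)%N) tnth X i ^+ sumn (phi X lam i (rep B))) *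
    (\prod_(i < N | (i < n)%N)
       (schur R[i] (in_tuple (phi X lam i (rep B)))).@[fun=> 1]) *
    (\prod_(i < N)
       \prod_(j < N | (i < j)%N && (tnth X (rep B i) != tnth X (rep B j)))
         (1 / (tnth X (rep B i) - tnth X (rep B j)))).
Proof. exact: schur_eval_coset_sum. Qed.
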